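(* Let $a\in\mathbb{R}$, $\epsilon>0$, $t_n=n\epsilon$ for $n\ge0$, let $B_t$ be a one-dimensional standard Brownian motion with $B_0=0$, and let $\overline{B}_t:=B_{t_n}+\frac{t-t_n}{\epsilon}(B_{t_{n+1}}-B_{t_n})$ for $t_n\le t<t_{n+1}$. For $x\in\mathbb{R}$ let $X_t(x)$ and $\overline{X}_t(x)$ be the solutions of $$dX_t(x)=a\,X_t(x)\,dt+dB_t,\qquad d\overline{X}_t(x)=a\,\overline{X}_t(x)\,dt+d\overline{B}_t,\qquad X_0(x)=\overline{X}_0(x)=x.$$ (1) If $a<0$, then $$\sup_{n\ge0}\mathbb{E}\left((X_{t_n}(x)-\overline{X}_{t_n}(x))^2\right)\le c(\epsilon)\,\epsilon^2\quad\text{with}\quad c(\epsilon):=e^{2|a|\epsilon}\,\frac{|a|}{24}.$$ (2) If $a>0$, then for every $n\ge0$ $$\epsilon^2\,c_-(\epsilon)\left(e^{2at_n}-1\right)\le\mathbb{E}\left((X_{t_n}(x)-\overline{X}_{t_n}(x))^2\right)\le\epsilon^2\,c_+(\epsilon)\left(e^{2at_n}-1\right)$$ with $c_-(\epsilon):=\frac{a}{24}e^{-2a\epsilon}$ and $c_+(\epsilon):=\frac{a}{24}e^{2a\epsilon}$. *)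

(* Defs.v *)
From HB Require Import structures.
From mathcomp Require Import all_boot all_order all_algebra.
From mathcomp Require Import all_classical all_reals all_analysis.

Set Implicit Arguments.
Unset Strict Implicit.
Unset Printing Implicit Defensive.

Import Order.TTheory GRing.Theory Num.Theory.
Import numFieldNormedType.Exports.

Local Open Scope classical_set_scope.
Local Open Scope ring_scope.

(* The product rule over the whole index type implies the one over each
   subfamily, by taking A i := setT outside of the subfamily. *)
Definition mutually_independent d (T : measurableType d) (R : realType)
    (P : probability T R) (I : finType) (X : I -> T -> R) : Prop :=
  forall A : I -> set R, (forall i, measurable (A i)) ->
    P (\bigcap_i (X i @^-1` A i)) = (\prod_i P (X i @^-1` A i))%E.

(* Processes are indexed by R, but only the times t >= 0 are constrained.
   The second parameter of normal_prob is the standard deviation. *)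
Record standard_brownian_motion d (T : measurableType d) (R : realType)
    (P : probability T R) (B : R -> {RV P >-> R}) : Prop := {
  bm_start : \forall w \ae P, B 0 w = 0 ;
  bm_continuous :
    \forall w \ae P, {within `[0, +oo[, continuous (fun t => B t w)} ;
  bm_gaussian : forall s t : R, 0 <= s -> s < t ->
    forall A : set R, measurable A ->
      P ((fun w => B t w - B s w) @^-1` A)
      = normal_prob 0 (Num.sqrt (t - s)) A ;
  bm_independent : forall (n : nat) (t : nat -> R),
    0 <= t 0%N -> (forall i, (i < n)%N -> t i <= t i.+1) ->
    mutually_independent P (fun (i : 'I_n) w => B (t i.+1) w - B (t i) w)
}.

Definition grid (R : realType) (eps : R) (n : nat) : R := n%:R * eps.

(* For eps > 0 and t >= 0, n := truncn (t / eps) is the unique natural number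
   with grid eps n <= t < grid eps n.+1. *)
Definition interpolation (R : realType) (eps : R) (b : R -> R) (t : R) : R :=
  let n := Num.truncn (t / eps) in
  b (grid eps n)
  + (t - grid eps n) / eps * (b (grid eps n.+1) - b (grid eps n)).

(* dX_t = a X_t dt + dZ_t, X_0 = x. The noise being additive, this is the
   pathwise integral equation, with dZ integrating to Z_t - Z_0; it gives
   X_0 = x at t = 0. *)
Definition linear_sde_solution d (T : measurableType d) (R : realType)
    (P : probability T R) (a x : R) (Z : R -> T -> R)
    (X : R -> {RV P >-> R}) : Prop :=
  \forall w \ae P,
    {within `[0, +oo[, continuous (fun t => X t w)} /\
    forall t : R, 0 <= t ->
      X t w = x + a * (\int[lebesgue_measure]_(s in `[0, t]) X s w)
              + (Z t w - Z 0 w).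

(* Main.v *)
Require Import Defs.
From HB Require Import structures.
From mathcomp Require Import all_boot all_order all_algebra.
From mathcomp Require Import all_classical all_reals all_analysis.
From mathcomp Require Import measurable_realfun.
From mathcomp Require Import ring lra.

Set Implicit Arguments.
Unset Strict Implicit.
Unset Printing Implicit Defensive.

Import Order.TTheory GRing.Theory Num.Theory.
Import numFieldNormedType.Exports.

Local Open Scope classical_set_scope.
Local Open Scope ring_scope.

(** Write [beta_t] for the gap between the Brownian path and its interpolation,
    and [Delta] for the difference of the two solutions.  Almost surely
    [Delta_t = a I_t + beta_t] with [I_t] the integral of [Delta] over [[0, t]],
    hence [exp (- a t) I_t] has derivative [exp (- a t) beta_t], and since [beta]
    vanishes on the grid,
      [Delta_(t_n) = a exp (a t_n) * integral_0^(t_n) exp (- a s) beta_s ds].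

    On the cell [[t_k, t_k + eps]] the process [beta] is a Brownian bridge, with
    covariance [min (u, v) - u v / eps >= 0], and bridges of distinct cells are
    uncorrelated.  The second moment of the integral is therefore
      [sum_(k < n) exp (- 2 a t_k) * J],
    where [J] is the integral of [exp (- a (u + v)) (min (u, v) - u v / eps)]
    over [[0, eps]^2].  The kernel alone integrates to [eps^3 / 12]; bounding the
    exponential weight from above and below, summing the geometric progression
    and using [1 + y <= exp y] gives all three estimates.

    The integral of [beta] is handled through its Riemann sums, which are finite
    combinations of values of the Brownian motion, so that no measurability in
    time and space jointly is involved.  [cvg_riemann_sum_linear_ode] gives
    their almost sure convergence.  Fatou's lemma turns it into mean-square
    convergence, with an explicit rate obtained from the modulus of continuity
    of the bridges in mean square ([increment_approx],
    [bridge_integral_approx]).  The second moments of the Riemann sums are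
    computed from the covariances ([inner_bridge_riemann_sum_bounds]) and pass
    to the limit ([inner_limit_bounds]).  The covariance of Brownian motion
    comes by polarization from [E (B_t - B_s)^2 = t - s]. *)

(** * The second moment of the centred normal law *)

(** The density is a version of the Radon-Nikodym derivative, so this is a
    change of variables. *)
Lemma integral_normal_prob_ge0 (R : realType) (m s : R) (f : R -> R) :
  measurable_fun setT f -> (forall y, 0 <= f y) ->
  (\int[normal_prob m s]_y (f y)%:E =
   \int[lebesgue_measure]_y (f y * normal_pdf m s y)%:E)%E.
Proof.
move=> mf f0.
have dom := @normal_prob_dominates R m s.
pose g := Radon_Nikodym_SigmaFinite.f (normal_prob m s) lebesgue_measure.
have ig : lebesgue_measure.-integrable setT g.
  exact: Radon_Nikodym_SigmaFinite.f_integrable.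
have gE : ae_eq lebesgue_measure setT g (EFin \o normal_pdf m s).
  apply: integral_ae_eq => //.
    by apply/measurable_EFinP; exact: measurable_normal_pdf.
  by move=> A _ mA; rewrite -Radon_Nikodym_SigmaFinite.f_integral.
rewrite -(Radon_Nikodym_SigmaFinite.change_of_variables dom) //; last first.
  exact/measurable_EFinP.
apply: ge0_ae_eq_integral => //.
- apply: emeasurable_funM; [exact/measurable_EFinP|exact: measurable_int ig].
- apply/measurable_EFinP/measurable_funM => //; exact: measurable_normal_pdf.
- by move=> y _; rewrite mule_ge0 ?lee_fin// Radon_Nikodym_SigmaFinite.f_ge0.
- by move=> y _; rewrite lee_fin mulr_ge0// normal_pdf_ge0.
- by apply: filterS gE => y /= /[apply]; rewrite EFinM /g => ->.
Qed.

(** Gaussian integration by parts rests on this differential equation of the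
    density. *)
Lemma is_derive_normal_pdf (R : realType) (s x : R) : s != 0 ->
  is_derive x 1 (normal_pdf 0 s) (- (x / s ^+ 2) * normal_pdf 0 s x).
Proof.
move=> s0; rewrite normal_pdfE// /normal_fun.
apply: is_derive_eq; rewrite /GRing.scale /=.
by field.
Qed.

Lemma normal_pdf_sym (R : realType) (s x : R) :
  s != 0 -> normal_pdf 0 s (- x) = normal_pdf 0 s x.
Proof. by move=> s0; rewrite !normal_pdfE// /normal_fun !subr0 sqrrN. Qed.

Lemma integral_normal_pdf_half (R : realType) (s : R) : s != 0 ->
  (\int[lebesgue_measure]_(x in `[0%R, +oo[) (normal_pdf 0 s x)%:E =
   (2^-1)%:E)%E.
Proof.
move=> s0; have := integral_normal_pdf 0 s.
rewrite ge0_symfun_integralT; first last.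
- by move=> x /=; rewrite normal_pdf_sym.
- exact: continuous_normal_pdf.
- exact: normal_pdf_ge0.
rewrite -set_itvcy; case: (integral _ _ _) => [r| |] //=.
- by rewrite -EFinM => -[] r1; congr EFin; lra.
- by rewrite gt0_muley.
- by rewrite gt0_muleNy.
Qed.

Lemma cvg_mul_normal_pdf (R : realType) (s : R) : s != 0 ->
  n%:R * normal_pdf 0 s n%:R @[n --> \oo] --> (0 : R).
Proof.
move=> s0; have s2 : 0 < s ^+ 2 by rewrite exprn_even_gt0.
apply: (@squeeze_cvgr _ _ _ _ (fun=> 0)
  (fun n : nat => (2 * normal_peak s * s ^+ 2) * n%:R^-1)).
- near=> n; have n0 : 0 < n%:R :> R by rewrite ltr0n; near: n; exists 1%N.
  rewrite mulr_ge0// ?normal_pdf_ge0//=.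
  rewrite normal_pdfE// /normal_fun subr0.
  (* exp (- q) <= 1 / q with q = n^2 / (2 s^2) *)
  rewrite mulrCA.
  rewrite [leRHS](_ : _ = normal_peak s * (2 * s ^+ 2 / n%:R)); last ring.
  rewrite ler_wpM2l ?normal_peak_ge0//.
  rewrite mulNr expRN.
  set q := (n%:R ^+ 2 / _ : R).
  have q0 : 0 < q by rewrite divr_gt0// ?exprn_gt0// mulr2n addr_gt0.
  apply: (@le_trans _ _ (n%:R * q^-1)).
    rewrite ler_wpM2l ?ler0n// lef_pV2 ?posrE ?expR_gt0//.
    by apply: le_trans (expR_ge1Dx q); rewrite lerDr.
  rewrite le_eqVlt; apply/orP; left; apply/eqP; rewrite /q -mulr_natr.
  by field; rewrite s0/= gt_eqF.
- exact: cvg_cst.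
- rewrite -[X in _ --> X](mulr0 (2 * normal_peak s * s ^+ 2)).
  apply: cvgMr; rewrite -(cvg_shiftS (fun n => n%:R^-1 : R)).
  exact: cvg_harmonic.
Unshelve. all: by end_near. Qed.

(** Integration by parts of [x * (x * pdf x)], where [- s^2 pdf] is a primitive
    of [x * pdf x]. *)
Lemma integral_sqr_normal_pdf_itv (R : realType) (s b : R) : s != 0 -> 0 < b ->
  (\int[lebesgue_measure]_(x in `[0%R, b]) (x ^+ 2 * normal_pdf 0 s x)%:E =
   (s ^+ 2)%:E * \int[lebesgue_measure]_(x in `[0%R, b]) (normal_pdf 0 s x)%:E
   - (s ^+ 2 * (b * normal_pdf 0 s b))%:E)%E.
Proof.
move=> s0 b0.
have dpdf (x : R) :
    is_derive x 1 (normal_pdf 0 s) (- (x / s ^+ 2) * normal_pdf 0 s x).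
  exact: is_derive_normal_pdf.
pose G x := - s ^+ 2 * normal_pdf 0 s x.
have dG (x : R) : is_derive x 1 G (x * normal_pdf 0 s x).
  by apply: is_derive_eq; rewrite /GRing.scale /=; field.
have cG : continuous G.
  by move=> x; apply/differentiable_continuous/derivable1_diffP; case: (dG x).
have cid : continuous (@idfun R) by move=> x; exact: cvg_id.
have cpdf : continuous (normal_pdf 0 s) by exact: continuous_normal_pdf.
have LR (f : R -> R) : continuous f -> (forall x, derivable f x 1) ->
    derivable_oo_LRcontinuous f 0 b.
  move=> cf df; split => [x _|/=|/=]; first exact: df.
    by apply: cvg_at_right_filter; exact: cf.
  by apply: cvg_at_left_filter; exact: cf.
have ipdf : lebesgue_measure.-integrable `[0%R, b] (EFin \o normal_pdf 0 s).
  apply: continuous_compact_integrable; first exact: segment_compact.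
  exact: continuous_subspaceT.
have := @integration_by_parts R idfun G (cst 1)
  (fun x => x * normal_pdf 0 s x) 0 b b0.
move=> /(_ _ _ _ _ _ _)/= IBP.
under eq_integral do rewrite expr2 -mulrA.
rewrite IBP; first last.
- by move=> x _; rewrite derive1E; have [_ ->] := dG x.
- by apply: LR => // x; case: (dG x).
- apply: continuous_subspaceT => x.
  by apply: cvgM; [exact: cvg_id|exact: cpdf].
- by move=> x _; rewrite derive1E derive_id.
- by apply: LR.
- by apply: continuous_subspaceT => x; exact: cvg_cst.
rewrite mul0r subr0.
under [in LHS]eq_integral do rewrite mul1r EFinM.
rewrite integralZl//.
have : (\int[lebesgue_measure]_(x in `[0%R, b]) (normal_pdf 0 s x)%:E)%E
    \is a fin_num by exact: integrable_fin_num.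
move=> /fineK <-; rewrite /G -!EFinM -!EFinN -!EFinD; congr EFin; ring.
Qed.

Lemma second_moment_normal (R : realType) (s : R) : s != 0 ->
  (\int[normal_prob 0 s]_y (y ^+ 2)%:E = (s ^+ 2)%:E)%E.
Proof.
move=> s0; pose f x := x ^+ 2 * normal_pdf 0 s x.
have cf : continuous f.
  move=> x; apply: cvgM; [exact: exprn_continuous|exact: continuous_normal_pdf].
have f0 x : 0 <= f x by rewrite mulr_ge0 ?sqr_ge0 ?normal_pdf_ge0.
have mpdf := @measurable_normal_pdf R 0 s.
rewrite integral_normal_prob_ge0//; last by move=> y; exact: sqr_ge0.
rewrite -/(f _) ge0_symfun_integralT//; last first.
  by move=> x /=; rewrite /f sqrrN normal_pdf_sym.
rewrite -set_itvcy.
suff -> : (\int[lebesgue_measure]_(x in `[0%R, +oo[) (f x)%:E =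
    (s ^+ 2 / 2)%:E)%E by rewrite -EFinM; congr EFin; field.
have mf : measurable_fun setT f by exact: continuous_measurable_fun.
have /cvg_lim <- // := @ge0_cvgn_integral R lebesgue_measure f f0 mf.
apply/cvg_lim => //.
have := @ge0_cvgn_integral R lebesgue_measure _ (normal_pdf_ge0 0 s) mpdf.
rewrite integral_normal_pdf_half//.
move=> /(cvgeZl (y := (s ^+ 2)%:E) erefl) h1.
have h2 : (s ^+ 2 * (n%:R * normal_pdf 0 s n%:R))%:E @[n --> \oo] -->
    (0 : R)%:E.
  apply: cvg_EFin; first exact: nearW.
  rewrite -[X in _ --> X](mulr0 (s ^+ 2)); apply: cvgMr.
  exact: cvg_mul_normal_pdf.
have := cvgeB _ h1 h2; rewrite -EFinM sube0 => /(_ _)/= h3.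
apply: cvg_trans (h3 _) => //; apply: near_eq_cvg; near=> n.
rewrite integral_sqr_normal_pdf_itv// ltr0n.
by near: n; exists 1%N.
Unshelve. all: by end_near. Qed.

(** * Square-integrable random variables as an inner product space *)

Notation L2 P := (LfunType P (lee1n 2)).

Section square_integrable.
Context d (T : measurableType d) (R : realType) (P : probability T R).
Implicit Types (X Y Z : L2 P) (c : R).

Lemma Lfun2_of_expectation_sqr (X : T -> R) : measurable_fun setT X ->
  ('E_P[fun w => (X w ^+ 2)%R] < +oo)%E -> X \in Lfun P 2%:E.
Proof.
move=> mX X2; rewrite inE; apply/andP; split; rewrite inE//=.
rewrite /finite_norm unlock /Lnorm poweR_lty//.
move: X2; rewrite unlock; congr (_ < _)%E; apply: eq_integral => w _.
by rewrite /= powR_mulrn// real_normK// num_real.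
Qed.

Definition L2_of_expectation_sqr (X : T -> R) (mX : measurable_fun setT X)
    (X2 : ('E_P[fun w => (X w ^+ 2)%R] < +oo)%E) : L2 P :=
  Lfun_Sub (lee1n 2) (Lfun2_of_expectation_sqr mX X2).

Definition inner X Y : R := \int[P]_w (X w * Y w).

Lemma integrable_mul_L2 X Y :
  P.-integrable setT (EFin \o (fun w => X w * Y w)).
Proof.
by apply/Lfun1_integrable; exact: Lfun2_mul_Lfun1 (LfunP X) (LfunP Y).
Qed.

Lemma measurable_L2 X : measurable_fun setT X.
Proof. by have := LfunP X; rewrite inE => /andP[/[!inE]]. Qed.

Lemma innerC X Y : inner X Y = inner Y X.
Proof. by apply: eq_Rintegral => w _; rewrite mulrC. Qed.

Lemma innerDl X Y Z : inner (X + Y) Z = inner X Z + inner Y Z.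
Proof.
rewrite /inner -RintegralD//; [|exact: integrable_mul_L2..].
by apply: eq_Rintegral => w _; rewrite -mulrDl.
Qed.

Lemma innerZl c X Y : inner (c *: X) Y = c * inner X Y.
Proof.
rewrite /inner -RintegralZl//; last exact: integrable_mul_L2.
by apply: eq_Rintegral => w _; rewrite mulrA.
Qed.

Lemma innerNl X Y : inner (- X) Y = - inner X Y.
Proof. by rewrite -scaleN1r innerZl mulN1r. Qed.

Lemma innerBl X Y Z : inner (X - Y) Z = inner X Z - inner Y Z.
Proof. by rewrite innerDl innerNl. Qed.

Lemma innerDr X Y Z : inner Z (X + Y) = inner Z X + inner Z Y.
Proof. by rewrite innerC innerDl !(innerC Z). Qed.

Lemma innerZr c X Y : inner Y (c *: X) = c * inner Y X.
Proof. by rewrite innerC innerZl (innerC Y). Qed.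

Lemma innerBr X Y Z : inner Z (X - Y) = inner Z X - inner Z Y.
Proof. by rewrite innerC innerBl !(innerC Z). Qed.

Lemma inner0l Y : inner 0 Y = 0.
Proof. by rewrite -(scale0r 0) innerZl mul0r. Qed.

Lemma inner_suml (I : finType) (X : I -> L2 P) Y :
  inner (\sum_i X i) Y = \sum_i inner (X i) Y.
Proof.
by elim/big_rec2: _ => [|i y1 y2 _ <-]; [exact: inner0l|rewrite innerDl].
Qed.

Lemma inner_sumr (I : finType) (X : I -> L2 P) Y :
  inner Y (\sum_i X i) = \sum_i inner Y (X i).
Proof. by rewrite innerC inner_suml; under eq_bigr do rewrite innerC. Qed.

Lemma inner_ge0 X : 0 <= inner X X.
Proof. by apply: Rintegral_ge0 => w _; rewrite -expr2 sqr_ge0. Qed.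

Lemma expectation_sqrE X :
  ('E_P[fun w => (X w ^+ 2)%R] = (inner X X)%:E)%E.
Proof.
rewrite unlock /inner /Rintegral fineK; last first.
  exact: integrable_fin_num (integrable_mul_L2 X X).
by apply: eq_integral => w _; rewrite expr2.
Qed.

Lemma L2_sumE (I : finType) (X : I -> L2 P) w :
  (\sum_i X i : L2 P) w = \sum_i X i w.
Proof. by elim/big_ind2 : _ => // ? ? ? ? <- <-. Qed.

Lemma inner_sqrD_le X Y :
  inner (X + Y) (X + Y) <= 2 * inner X X + 2 * inner Y Y.
Proof.
have := inner_ge0 (X - Y); rewrite !(innerBl, innerBr, innerDl, innerDr).
by rewrite (innerC Y X) => ?; lra.
Qed.

(** The Cauchy-Schwarz inequality against the constant family, obtained from
    [2 x y <= x^2 + y^2] on each pair of terms. *)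
Lemma inner_sqr_sum_le (I : finType) (X : I -> L2 P) :
  inner (\sum_i X i) (\sum_i X i) <= #|I|%:R * \sum_i inner (X i) (X i).
Proof.
rewrite inner_suml; under eq_bigr do rewrite inner_sumr.
apply: (@le_trans _ _ (\sum_i \sum_j
    (2^-1 * inner (X i) (X i) + 2^-1 * inner (X j) (X j)))).
  apply: ler_sum => i _; apply: ler_sum => j _.
  have := inner_ge0 (X i - X j); rewrite !(innerBl, innerBr).
  by rewrite (innerC (X j) (X i)) => ?; lra.
under eq_bigr do rewrite big_split/= sumr_const -mulr_sumr.
rewrite big_split/= sumr_const sumrMnl -mulr_sumr -mulrnDl -mulrDl.
by rewrite -[leLHS]mulr_natl [(2^-1 + 2^-1 : R)](_ : _ = 1) ?mul1r//; lra.
Qed.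
End square_integrable.

(** * Covariance of Brownian motion and of its bridges *)

(** The codomain is retyped so that the law of [D] and [m] live on the same
    measurable space of reals. *)
Lemma integral_comp_law d (T : measurableType d) (R : realType)
    (P : probability T R) (m : {measure set (measurableTypeR R) -> \bar R})
    (D : T -> R) (f : R -> R) :
  measurable_fun setT D -> measurable_fun setT f -> (forall y, 0 <= f y) ->
  (forall A, measurable A -> P (D @^-1` A) = m A) ->
  (\int[P]_w (f (D w))%:E = \int[m]_y (f y)%:E)%E.
Proof.
move=> mD mf f0 lawD.
have mD' : measurable_fun setT (D : T -> measurableTypeR R) by exact: mD.
have mf' : measurable_fun setT (fun y : measurableTypeR R => (f y)%:E).
  exact/measurable_EFinP.
rewrite -[LHS](@ge0_integral_pushforward _ _ T (measurableTypeR R) R D mD' P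
  setT (fun y => (f y)%:E))//; last by move=> y _; rewrite lee_fin.
by apply: eq_measure_integral => A mA _; exact: lawD.
Qed.

Section brownian_covariance.
Context d (T : measurableType d) (R : realType) (P : probability T R).
Variables (B : R -> {RV P >-> R}) (hB : standard_brownian_motion B).

Lemma expectation_sqr_increment (s t : R) : 0 <= s -> s <= t ->
  ('E_P[fun w => ((B t w - B s w) ^+ 2)%R] = (t - s)%:E)%E.
Proof.
move=> s0; rewrite le_eqVlt => /predU1P[<-|st].
  rewrite subrr -[RHS](expectation_cst P); congr expectation.
  by apply/funext => w /=; rewrite subrr expr0n.
have mD : measurable_fun setT (fun w => B t w - B s w).
  exact: measurable_funB.
have ts : Num.sqrt (t - s) != 0 by rewrite gt_eqF// sqrtr_gt0 subr_gt0.
rewrite -[t - s in RHS]sqr_sqrtr ?subr_ge0 ?ltW//.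
rewrite -second_moment_normal// unlock.
apply: (@integral_comp_law _ _ _ _ (normal_prob 0 (Num.sqrt (t - s))) _
  (fun y => y ^+ 2)) => //.
- by move=> y; exact: sqr_ge0.
- by move=> A mA; exact: (bm_gaussian hB).
Qed.

Lemma measurable_increment (s t : R) :
  measurable_fun setT (fun w => B t w - B s w).
Proof. exact: measurable_funB. Qed.

Lemma Lfun2_position (t : R) : 0 <= t ->
  (fun w => B t w - B 0 w) \in Lfun P 2%:E.
Proof.
move=> t0; apply: Lfun2_of_expectation_sqr; first exact: measurable_increment.
by rewrite expectation_sqr_increment// ltry.
Qed.

(** [B t - B 0] rather than [B t], whose second moment is not given by the law
    of an increment; extended by 0 to negative times, where [B] is
    unconstrained. *)
Definition position (t : R) : L2 P :=
  if pselect (0 <= t) is left t0 then Lfun_Sub (lee1n 2) (Lfun2_position t0)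
  else 0.

Lemma positionE (t : R) w : 0 <= t -> position t w = B t w - B 0 w.
Proof. by rewrite /position; case: pselect. Qed.

(** Polarization: the squared norms of the positions at [s] and [t] and of their
    difference are [s], [t] and [t - s]. *)
Lemma inner_position (s t : R) : 0 <= s -> s <= t ->
  inner (position s) (position t) = s.
Proof.
move=> s0 st; have t0 := le_trans s0 st.
have sqr u v : 0 <= u -> u <= v ->
    inner (position v - position u) (position v - position u) = v - u.
  move=> u0 uv; apply: EFin_inj; rewrite -expectation_sqrE.
  rewrite -expectation_sqr_increment//; congr expectation; apply/funext => w.
  rewrite -[(_ - _ : L2 P) w]/(position v w - position u w) !positionE//.
    by congr (_ ^+ 2); ring.
  exact: le_trans uv.
have p0 : position 0 = 0.
  apply/LfuneqP => w; rewrite positionE// subrr//.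
have := sqr _ _ s0 st; have := sqr _ _ (lexx 0) s0.
have := sqr _ _ (lexx 0) t0; rewrite p0 !subr0 => tt ss.
by rewrite !(innerBl, innerBr) tt ss (innerC (position t)) => ?; lra.
Qed.

End brownian_covariance.

(** The gap at time [grid eps k + u] between [W] and its linear interpolation on
    the k-th cell. *)
Definition bridge (R : realType) (V : lmodType R) (W : R -> V) (eps : R)
    (k : nat) (u : R) : V :=
  W (grid eps k + u) - W (grid eps k)
  - (u / eps) *: (W (grid eps k.+1) - W (grid eps k)).

Section bridge_covariance.
Context d (T : measurableType d) (R : realType) (P : probability T R).
Variables (W : R -> L2 P) (eps : R).
Hypothesis eps0 : 0 < eps.
Hypothesis cov : forall s t, 0 <= s -> s <= t -> inner (W s) (W t) = s.

Lemma gridS k : grid eps k.+1 = grid eps k + eps.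
Proof. by rewrite /grid -natr1 mulrDl mul1r. Qed.

Lemma grid_ge0 k : 0 <= grid eps k.
Proof. by rewrite mulr_ge0// ltW. Qed.

Lemma le_grid k l : (k <= l)%N -> grid eps k <= grid eps l.
Proof. by move=> kl; rewrite ler_wpM2r ?ler_nat// ltW. Qed.

Lemma inner_bridge_le k u v : 0 <= u -> u <= v -> v <= eps ->
  inner (bridge W eps k u) (bridge W eps k v) = u - u * v / eps.
Proof.
move=> u0 uv ve; have v0 := le_trans u0 uv; have k0 := grid_ge0 k.
rewrite /bridge gridS; set t := grid eps k in k0 *.
rewrite !(innerBl, innerBr, innerZl, innerZr).
have covC s s' : 0 <= s -> s <= s' -> inner (W s') (W s) = s.
  by move=> *; rewrite innerC cov.
have -> : inner (W (t + u)) (W (t + v)) = t + u by apply: cov; lra.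
have -> : inner (W (t + u)) (W t) = t by apply: covC; lra.
have -> : inner (W (t + u)) (W (t + eps)) = t + u by apply: cov; lra.
have -> : inner (W t) (W (t + v)) = t by apply: cov; lra.
have -> : inner (W t) (W t) = t by apply: cov; lra.
have -> : inner (W t) (W (t + eps)) = t by apply: cov; lra.
have -> : inner (W (t + eps)) (W (t + v)) = t + v by apply: covC; lra.
have -> : inner (W (t + eps)) (W t) = t by apply: covC; lra.
have -> : inner (W (t + eps)) (W (t + eps)) = t + eps by apply: cov; lra.
by field; rewrite gt_eqF.
Qed.

Lemma inner_bridge k u v : 0 <= u <= eps -> 0 <= v <= eps ->
  inner (bridge W eps k u) (bridge W eps k v) = Num.min u v - u * v / eps.
Proof.
move=> /andP[u0 ue] /andP[v0 ve]; have [uv|/ltW vu] := leP u v.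
  by rewrite inner_bridge_le.
by rewrite innerC inner_bridge_le// (mulrC u).
Qed.

(** All times of the cell [k] precede those of the cell [l], so each covariance
    depends on the point of the cell [k] only, and the increments over the cell
    [l] cancel. *)
Lemma inner_bridge_lt k l u v : (k < l)%N -> 0 <= u <= eps -> 0 <= v <= eps ->
  inner (bridge W eps k u) (bridge W eps l v) = 0.
Proof.
move=> kl /andP[u0 ue] /andP[v0 ve].
have := le_grid kl; have k0 := grid_ge0 k.
rewrite /bridge !gridS; set t := grid eps k in k0 *; set t' := grid eps l => tt'.
rewrite !(innerBl, innerBr, innerZl, innerZr).
by rewrite !cov; lra.
Qed.

Lemma inner_bridge_neq k l u v : k != l -> 0 <= u <= eps -> 0 <= v <= eps ->
  inner (bridge W eps k u) (bridge W eps l v) = 0.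
Proof.
rewrite neq_ltn => /orP[kl|lk] hu hv; first exact: inner_bridge_lt.
by rewrite innerC inner_bridge_lt.
Qed.

Lemma inner_sqr_bridge_le k u : 0 <= u <= eps ->
  inner (bridge W eps k u) (bridge W eps k u) <= eps.
Proof.
move=> hu; rewrite inner_bridge// minxx; case/andP: hu => u0 ue.
by apply: le_trans ue; rewrite gerBl divr_ge0 ?mulr_ge0// ltW.
Qed.

Lemma inner_sqr_bridgeB_le k u v : 0 <= u -> u <= v -> v <= eps ->
  inner (bridge W eps k v - bridge W eps k u)
        (bridge W eps k v - bridge W eps k u) <= v - u.
Proof.
move=> u0 uv ve; have v0 := le_trans u0 uv; have ue := le_trans uv ve.
(* the exact value is (v - u) - (v - u)^2 / eps *)
have := inner_bridge_le k u0 (lexx u) ue; have := inner_bridge_le k u0 uv ve.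
have := inner_bridge_le k v0 (lexx v) ve.
move: (bridge W eps k u) (bridge W eps k v) => x y yy xy xx.
rewrite !(innerBl, innerBr) (innerC y x) yy xy xx.
have : 0 <= (v - u) ^+ 2 / eps by rewrite divr_ge0 ?sqr_ge0// ltW.
have -> : (v - u) ^+ 2 / eps = v * v / eps - 2 * (u * v / eps) + u * u / eps.
  by field; rewrite gt_eqF.
by move=> ?; lra.
Qed.

End bridge_covariance.

(** * Riemann sums and a linear integral equation *)

(** Heine's theorem in near-covering form: at each point of the segment, all small
    enough [r] also work for the nearby points, so compactness gives one [r] for
    the whole segment. *)
Lemma segment_uniform_continuity (R : realType) (f : R -> R) (u v e : R) :
  {within `[u, v], continuous f} -> 0 < e ->
  exists2 r, 0 < r & forall x y, x \in `[u, v] -> y \in `[u, v] ->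
    `|x - y| < r -> `|f x - f y| < e.
Proof.
move=> /subspace_continuousP cf e0.
have /compact_near_coveringP/near_covering_withinP := @segment_compact R u v.
pose P (r x : R) := forall y : R, y \in `[u, v] -> `|x - y| < r ->
  `|f x - f y| < e.
move=> /(_ _ (0 : R)^'+ P _) [].
  move=> x xuv.
  have /cvgrPdist_lt/(_ (e / 2)) := cf x xuv.
  rewrite divr_gt0// => /(_ isT); rewrite near_withinE => -[/= n n0 xn].
  exists (ball x (n / 2), [set r | r < n / 2]) => /=.
    split; first by apply: nbhsx_ballx; rewrite divr_gt0.
    by apply: nbhs_right_lt; rewrite divr_gt0.
  move=> [z r] /= [xz rn] zuv y yuv zy.
  have fz : `|f x - f z| < e / 2.
    apply: xn => //=; apply: (lt_le_trans xz).
    by rewrite ler_pdivrMr//; move: n0 => /= ?; lra.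
  have fy : `|f x - f y| < e / 2.
    apply: xn => //=; rewrite [ltRHS]splitr -(subrKA z).
    by apply: le_lt_trans (ler_normD _ _) _; apply: ltrD => //; apply: lt_trans rn.
  rewrite [ltRHS]splitr -(subrKA (f x)).
  by apply: le_lt_trans (ler_normD _ _) _; apply: ltrD => //; rewrite distrC.
move=> r /= r0 rP; exists (r / 2); first by rewrite divr_gt0.
move=> x y xuv yuv xy; apply: (rP (r / 2)) => //=.
- rewrite sub0r normrN gtr0_norm ?divr_gt0//.
  by rewrite ltr_pdivrMr//; lra.
- by rewrite divr_gt0.
Qed.

Definition riemann_sum (R : realType) (f : R -> R) (u v : R) (l : nat) : R :=
  (v - u) / l%:R * \sum_(j < l) f (u + j%:R * ((v - u) / l%:R)).

(** The mean value theorem on each subinterval reduces the error to an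
    oscillation of [f], controlled by uniform continuity. *)
Lemma cvg_riemann_sum (R : realType) (f F : R -> R) (u v : R) : u < v ->
  {within `[u, v], continuous f} -> {within `[u, v], continuous F} ->
  (forall x, x \in `]u, v[ -> is_derive x 1 F (f x)) ->
  riemann_sum f u v l @[l --> \oo] --> F v - F u.
Proof.
move=> uv cf cF dF; have vu0 : 0 < v - u by rewrite subr_gt0.
apply/cvgrPdist_le => e e0.
have [r r0 fr] := segment_uniform_continuity cf (divr_gt0 e0 vu0).
near=> l.
have l0 : 0 < l%:R :> R by rewrite ltr0n; near: l; exists 1%N.
set h := (v - u) / l%:R.
have h0 : 0 < h by rewrite divr_gt0.
have hr : h < r.
  rewrite /h ltr_pdivrMr// mulrC -ltr_pdivrMr//.
  by near: l; exact: nbhs_infty_gtr.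
have lh : l%:R * h = v - u by rewrite /h; field; rewrite gt_eqF.
pose p (j : nat) := u + j%:R * h.
have pS j : p j.+1 - p j = h by rewrite /p -natr1; ring.
have up j : u <= p j by rewrite /p lerDl mulr_ge0// ltW.
have pv (j : nat) : (j <= l)%N -> p j <= v.
  move=> jl; rewrite /p -lerBrDl -lh ler_wpM2r ?ler_nat//; exact: ltW.
have -> : F v - F u = \sum_(j < l) (F (p j.+1) - F (p j)).
  have := telescope_sumr (fun j => F (p j)) (leq0n l).
  rewrite big_mkord => ->; rewrite /p mul0r addr0 lh.
  by congr (F _ - _); ring.
rewrite /riemann_sum -/h mulr_sumr -sumrB.
apply: le_trans (ler_norm_sum _ _ _) _.
apply: (@le_trans _ _ (\sum_(j < l) (h * (e / (v - u))))); last first.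
  rewrite sumr_const card_ord -mulr_natl mulrA lh.
  by rewrite le_eqVlt; apply/orP; left; apply/eqP; field; rewrite gt_eqF.
apply: ler_sum => j _.
have jl : (j.+1 <= l)%N by [].
have pjS : p j < p j.+1 by rewrite -subr_gt0 pS.
have sub : `[p j, p j.+1] `<=` `[u, v].
  move=> x /=; rewrite !in_itv/= => /andP[px xp].
  by rewrite (le_trans (up j))//= (le_trans xp)// pv.
have [c cj ->] : exists2 c, c \in `]p j, p j.+1[ &
    F (p j.+1) - F (p j) = f c * (p j.+1 - p j).
  have cFj : {within `[p j, p j.+1], continuous F}.
    by apply: (continuous_subspaceW sub); exact: cF.
  have dFj x : x \in `]p j, p j.+1[ -> is_derive x 1 F (f x).
    rewrite in_itv/= => /andP[px xp]; apply: dF.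
    by rewrite in_itv/= (le_lt_trans (up j))//= (lt_le_trans xp)// pv.
  exact: MVT pjS dFj cFj.
have pj : p j \in `[u, v] by rewrite in_itv/= up pv// ltnW.
have cuv : c \in `[u, v].
  by apply: sub => /=; exact: subset_itv_oo_cc cj.
rewrite pS mulrC -mulrBr normrM gtr0_norm// ler_wpM2l// ?ltW//.
apply: fr => //; move: cj; rewrite in_itv/= => /andP[pc cp].
rewrite gtr0_norm ?subr_gt0//; apply: le_lt_trans hr.
by rewrite -[leRHS](pS j) lerD2r ltW.
Unshelve. all: by end_near. Qed.

(** The function [exp (- a t) I t] has derivative
    [exp (- a t) (D t - a I t) = exp (- a t) b t]. *)
Lemma cvg_riemann_sum_linear_ode (R : realType) (a : R) (D b : R -> R) :
  let I t := \int[lebesgue_measure]_(s in `[0, t]) D s in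
  {within `[0, +oo[, continuous D} ->
  (forall t, 0 <= t -> D t = a * I t + b t) ->
  forall u v, 0 <= u -> u < v ->
  riemann_sum (fun s => expR (- (a * s)) * b s) u v l @[l --> \oo] -->
  expR (- (a * v)) * I v - expR (- (a * u)) * I u.
Proof.
move=> I cD DE u v u0 uv.
have v0 : 0 < v by exact: le_lt_trans uv.
have c0v : {within `[0, v], continuous D}.
  apply: continuous_subspaceW cD => x /=.
  by rewrite !in_itv/= andbT => /andP[].
have iD : lebesgue_measure.-integrable `[0, v] (EFin \o D).
  by apply: continuous_compact_integrable => //; exact: segment_compact.
have cI : {within `[0, v], continuous I}.
  by apply: parameterized_integral_continuous => //; exact: ltW.
have sub : `[u, v] `<=` `[0, v].
  by move=> x /=; rewrite !in_itv/= => /andP[ux ->]; rewrite (le_trans u0).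
have cE : continuous (fun t : R => expR (- (a * t))).
  move=> t; apply: continuous_comp; last exact: continuous_expR.
  by apply: cvgN; apply: cvgMr; exact: cvg_id.
pose F t := expR (- (a * t)) * I t.
pose f t := expR (- (a * t)) * (D t - a * I t).
have cF : {within `[u, v], continuous F}.
  apply: (continuous_subspaceW sub); apply/subspace_continuousP => x x0v.
  apply: cvgM; first by apply: cvg_within_filter; exact: cE.
  by move/subspace_continuousP : cI; exact.
have cf : {within `[u, v], continuous f}.
  apply: (continuous_subspaceW sub); apply/subspace_continuousP => x x0v.
  apply: cvgM; first by apply: cvg_within_filter; exact: cE.
  apply: cvgB; first by move/subspace_continuousP : c0v; exact.
  by apply: cvgMr; move/subspace_continuousP : cI; exact.
have dF x : x \in `]u, v[ -> is_derive x 1 F (f x).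
  rewrite in_itv/= => /andP[ux xv].
  have x0 : 0 < x by exact: le_lt_trans ux.
  have cDx : {for x, continuous D}.
    have /continuous_within_itvcyP[+ _] := cD.
    by apply; rewrite in_itv/= x0.
  have [dI I'] := continuous_FTC1_closed xv iD x0 cDx.
  have dI' : is_derive x 1 I (D x).
    by apply: DeriveDef => //; rewrite -I' derive1E.
  by apply: is_derive_eq; rewrite /f /GRing.scale /=; ring.
have := cvg_riemann_sum uv cf cF dF; rewrite -/(F v) -/(F u).
apply: cvg_trans; apply: near_eq_cvg; apply: nearW => l.
rewrite /riemann_sum; congr (_ * _); apply: eq_bigr => j _.
rewrite /f; set t := u + _.
have t0 : 0 <= t by rewrite addr_ge0// mulr_ge0// divr_ge0// subr_ge0 ltW.
by rewrite (DE t t0); congr (_ * _); ring.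
Qed.

(** * Limits in mean square *)

Section mean_square_limit.
Context d (T : measurableType d) (R : realType) (P : probability T R).
Implicit Types X Y : L2 P.

Lemma fatou_mean_square (Z : T -> R) (Y : nat -> L2 P) (M : R) :
  measurable_fun setT Z ->
  (\forall w \ae P, Y l w @[l --> \oo] --> Z w) ->
  (forall l, inner (Y l) (Y l) <= M) ->
  ('E_P[fun w => (Z w ^+ 2)%R] <= M%:E)%E.
Proof.
move=> mZ YZ YM; rewrite unlock.
pose f l w := ((Y l w) ^+ 2)%:E.
have mf l : measurable_fun setT (f l).
  by apply/measurable_EFinP/measurable_funX; exact: measurable_L2.
have f0 l w : (0 <= f l w)%E by rewrite lee_fin sqr_ge0.
have -> : (\int[P]_w (Z w ^+ 2)%:E = \int[P]_w limn_einf (f ^~ w))%E.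
  apply: ge0_ae_eq_integral => //.
  - exact/measurable_EFinP/measurable_funX.
  - apply: measurableT_comp => //; apply: measurable_fun_limn_esup => l.
    exact: measurableT_comp.
  - by move=> w _; rewrite lee_fin sqr_ge0.
  - move=> w _; rewrite limn_einf_lim; apply: lime_ge.
      exact: is_cvg_einfs.
    apply: nearW => l; apply: le_ereal_inf_tmp => _ [j /= _ <-]; exact: f0.
  apply: filterS YZ => w Yw _; apply/esym.
  have /cvg_limn_einf_sup[-> //] : f ^~ w @ \oo --> (Z w ^+ 2)%:E.
  apply: cvg_EFin; first exact: nearW.
  rewrite /f /comp /=; under eq_fun do rewrite expr2.
  by rewrite expr2; apply: cvgM.
apply: (@le_trans _ _ (limn_einf (fun l => \int[P]_w f l w)%E)).
  by apply: fatou => // l w _; exact: f0.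
rewrite limn_einf_lim; apply: lime_le; first exact: is_cvg_einfs.
apply: nearW => l; apply: ge_ereal_inf.
exists (\int[P]_w f l w)%E; first by exists l => /=.
have -> : (\int[P]_w f l w = 'E_P[fun w => (Y l w ^+ 2)%R])%E by rewrite unlock.
by rewrite expectation_sqrE lee_fin.
Qed.

(** With [E = D - Y m], the squared norm of [Y m] differs from that of [D] by
    [|E|^2 - 2 (D, E)], and [2 |(D, E)| <= c |D|^2 + |E|^2 / c] for all [c > 0]. *)
Lemma cvg_inner_sqr (D : L2 P) (Y : nat -> L2 P) :
  inner (D - Y m) (D - Y m) @[m --> \oo] --> 0 ->
  inner (Y m) (Y m) @[m --> \oo] --> inner D D.
Proof.
move=> DY; have D0 := inner_ge0 D; apply/cvgrPdist_le => e e0.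
(* [c] makes the term [c |D|^2] at most e / 4; the two terms in [E] are made
   at most e / 4 by taking m large *)
pose c := e / (4 * (inner D D + 1)).
have c0 : 0 < c by rewrite divr_gt0// mulr_gt0// ltr_wpDl.
have cD : c * inner D D <= e / 4.
  rewrite /c -subr_ge0 (_ : _ - _ = e / 4 / (inner D D + 1)).
    by rewrite !divr_ge0 ?addr_ge0// ltW.
  by field; rewrite gt_eqF// ltr_wpDl.
have ce : 0 < c * (e / 4) by rewrite mulr_gt0// divr_gt0.
near=> m.
have E0 := inner_ge0 (D - Y m).
have E1 : inner (D - Y m) (D - Y m) <= e / 4.
  near: m; move/cvgrPdist_le : DY => /(_ (e / 4)).
  rewrite divr_gt0// => /(_ isT); apply: filterS => m; rewrite sub0r normrN.
  by rewrite ger0_norm ?inner_ge0.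
have E2 : inner (D - Y m) (D - Y m) <= c * (e / 4).
  near: m; move/cvgrPdist_le : DY => /(_ (c * (e / 4))).
  move=> /(_ ce); apply: filterS => m.
  by rewrite sub0r normrN ger0_norm ?inner_ge0.
have YE : Y m = D - (D - Y m) by rewrite opprB addrC subrK.
rewrite YE; move: (D - Y m) E0 E1 E2 => E E0 E1 E2.
have E3 : c^-1 * inner E E <= e / 4 by rewrite mulrC ler_pdivrMr// mulrC.
have p1 : 0 <= c * inner D D - 2 * inner D E + c^-1 * inner E E.
  have := inner_ge0 (c *: D - E).
  rewrite !(innerBl, innerBr, innerZl, innerZr) (innerC E D) => h.
  have : 0 <= c^-1 * (c * (c * inner D D) - c * inner D E -
      (c * inner D E - inner E E)) by rewrite mulr_ge0// invr_ge0 ltW.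
  congr (_ <= _); field; exact: lt0r_neq0.
have p2 : 0 <= c * inner D D + 2 * inner D E + c^-1 * inner E E.
  have := inner_ge0 (c *: D + E).
  rewrite !(innerDl, innerDr, innerZl, innerZr) (innerC E D) => h.
  have : 0 <= c^-1 * (c * (c * inner D D) + c * inner D E +
      (c * inner D E + inner E E)) by rewrite mulr_ge0// invr_ge0 ltW.
  congr (_ <= _); field; exact: lt0r_neq0.
rewrite !(innerBl, innerBr) (innerC E D) ler_norml.
by apply/andP; split; lra.
Unshelve. all: by end_near. Qed.

End mean_square_limit.

(** * The time integral of the damped bridges *)

Lemma sum_ord_cst (R : pzRingType) m (c : R) : \sum_(i < m) c = m%:R * c.
Proof. by rewrite sumr_const card_ord mulr_natl. Qed.

(** For [v <= u], [exp u - exp v <= exp u * (u - v)] is the inequality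
    [1 + y <= exp y] at [y = v - u]. *)
Lemma sqr_expRB_le (R : realType) (x y G : R) : expR x <= G -> expR y <= G ->
  (expR x - expR y) ^+ 2 <= G ^+ 2 * (x - y) ^+ 2.
Proof.
have aux u v : v <= u -> expR u <= G ->
    (expR u - expR v) ^+ 2 <= G ^+ 2 * (u - v) ^+ 2.
  move=> vu uG; rewrite -exprMn ler_sqr ?nnegrE; last 2 first.
  - by rewrite subr_ge0 ler_expR.
  - by rewrite mulr_ge0 ?subr_ge0// (le_trans (expR_ge0 u)).
  apply: (@le_trans _ _ (expR u * (u - v))); last by rewrite ler_wpM2r ?subr_ge0.
  have := expR_ge1Dx (v - u); rewrite expRB => h.
  have := ler_wpM2l (expR_ge0 u) h.
  rewrite [X in _ <= X](_ : _ = expR v); first by move=> ?; lra.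
  by field; rewrite gt_eqF ?expR_gt0.
move=> xG yG; have [xy|/ltW yx] := leP x y; last exact: aux.
by rewrite -sqrrN opprB -(sqrrN (x - y)) opprB; exact: aux.
Qed.

Section bridge_integral.
Context d (T : measurableType d) (R : realType) (P : probability T R).
Variables (W : R -> L2 P) (eps a : R) (Phi : R -> T -> R) (n : nat).
Hypothesis eps0 : 0 < eps.
Hypothesis cov : forall s t, 0 <= s -> s <= t -> inner (W s) (W t) = s.

Definition damped_bridge k u : L2 P :=
  expR (- (a * (grid eps k + u))) *: bridge W eps k u.

(* [Phi] plays the part of the primitive of the damped bridges; it is known only
   through the almost sure limits of the Riemann sums *)
Hypothesis mPhi : forall t, measurable_fun setT (Phi t).
Hypothesis cvgPhi : \forall w \ae P, forall k p q,
  0 <= p -> p < q -> q <= eps ->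
  riemann_sum (fun u => damped_bridge k u w) p q l @[l --> \oo] -->
  Phi (grid eps k + q) w - Phi (grid eps k + p) w.

(* [G] bounds the weights over the time interval, and [C] is the resulting
   mean-square Lipschitz constant of the damped bridges *)
Let G := expR (`|a| * grid eps n).
Let C := 2 * G ^+ 2 * (1 + a ^+ 2 * eps ^+ 2).

Lemma damping_le k u : (k < n)%N -> 0 <= u <= eps ->
  expR (- (a * (grid eps k + u))) <= G.
Proof.
move=> kn /andP[u0 ue]; rewrite ler_expR.
have k0 := grid_ge0 eps0 k.
have := le_grid eps0 kn; rewrite gridS => kS.
apply: (@le_trans _ _ (`|a| * (grid eps k + u))).
  by rewrite -mulNr ler_wpM2r ?addr_ge0// -normrN ler_norm.
by rewrite ler_wpM2l//; lra.
Qed.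

(** The increment splits into an increment of the bridge, of second moment at
    most [r - p], and an increment of the weight, Lipschitz in time. *)
Lemma damped_bridge_increment_le k p r : (k < n)%N ->
  0 <= p -> p <= r -> r <= eps ->
  inner (damped_bridge k r - damped_bridge k p)
        (damped_bridge k r - damped_bridge k p) <= C * (r - p).
Proof.
move=> kn p0 pr re; have r0 := le_trans p0 pr; have pe := le_trans pr re.
rewrite /damped_bridge.
have := inner_sqr_bridgeB_le eps0 cov k p0 pr re.
have := @inner_sqr_bridge_le _ _ _ _ W eps eps0 cov k p.
rewrite p0 pe => /(_ isT).
have er : expR (- (a * (grid eps k + r))) <= G by rewrite damping_le// r0.
have ep : expR (- (a * (grid eps k + p))) <= G by rewrite damping_le// p0.
have := sqr_expRB_le er ep.
set x := expR _ in er *; set y := expR _ in ep *.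
have x0 : 0 <= x by exact: expR_ge0.
move: (bridge W eps k r) (bridge W eps k p) => br bp xy bp2 brp2.
have -> : x *: br - y *: bp = x *: (br - bp) + (x - y) *: bp.
  by rewrite scalerBr scalerBl addrA subrK.
apply: le_trans (inner_sqrD_le _ _) _.
rewrite (innerZl x) (innerZr x) (innerZl (x - y)) (innerZr (x - y)).
have h1 : x * (x * inner (br - bp) (br - bp)) <= G ^+ 2 * (r - p).
  rewrite mulrA -expr2 ler_pM ?sqr_ge0 ?inner_ge0//.
  by rewrite ler_sqr ?nnegrE// (le_trans x0).
have h2 : (x - y) * ((x - y) * inner bp bp) <=
    G ^+ 2 * a ^+ 2 * eps ^+ 2 * (r - p).
  rewrite mulrA -expr2.
  apply: (@le_trans _ _ (G ^+ 2 * (a ^+ 2 * (r - p) ^+ 2) * eps)).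
    rewrite ler_pM ?sqr_ge0 ?inner_ge0//; apply: le_trans xy _.
    by rewrite le_eqVlt; apply/orP; left; apply/eqP; ring.
  rewrite -subr_ge0.
  rewrite (_ : _ - _ = (G * a) ^+ 2 * (eps * ((r - p) * (eps - (r - p)))));
    last ring.
  have rp : 0 <= r - p by lra.
  have erp : 0 <= eps - (r - p) by lra.
  by rewrite mulr_ge0 ?sqr_ge0// mulr_ge0 ?(ltW eps0)// mulr_ge0.
rewrite /C; apply: (@le_trans _ _ (2 * (G ^+ 2 * (r - p)) +
    2 * (G ^+ 2 * a ^+ 2 * eps ^+ 2 * (r - p)))).
  by apply: lerD; rewrite ler_pM2l.
by rewrite le_eqVlt; apply/orP; left; apply/eqP; ring.
Qed.

(** Fatou's lemma along the refinements of [[p, q]]: a Riemann sum minus its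
    one-point version is [q - p] times an average of increments of the damped
    bridge over durations at most [q - p], hence has second moment at most
    [(q - p)^2 * C (q - p)]. *)
Lemma increment_approx k p q : (k < n)%N -> 0 <= p -> p < q -> q <= eps ->
  {Z : L2 P | forall w, Z w = Phi (grid eps k + q) w - Phi (grid eps k + p) w
                               - (q - p) * damped_bridge k p w &
              inner Z Z <= C * (q - p) ^+ 3}.
Proof.
move=> kn p0 pq qe; have qp0 : 0 < q - p by rewrite subr_gt0.
pose Z w := Phi (grid eps k + q) w - Phi (grid eps k + p) w
            - (q - p) * damped_bridge k p w.
have mZ : measurable_fun setT Z.
  apply: measurable_funB; first exact: measurable_funB.
  by apply: measurable_funM => //; exact: measurable_L2.
(* sums with l + 1 points, as the sum without points is not an average *)
pose h l : R := (q - p) / l.+1%:R.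
have h0 l : 0 < h l by rewrite divr_gt0// ltr0n.
have lh l : l.+1%:R * h l = q - p by rewrite /h mulrC divfK// pnatr_eq0.
pose Y l : L2 P := \sum_(j < l.+1) h l *:
  (damped_bridge k (p + j%:R * h l) - damped_bridge k p).
have YM l : inner (Y l) (Y l) <= C * (q - p) ^+ 3.
  apply: le_trans (inner_sqr_sum_le _) _.
  apply: (@le_trans _ _ (l.+1%:R * \sum_(j < l.+1) (h l ^+ 2 * (C * (q - p))))).
    rewrite card_ord ler_wpM2l ?ler0n//; apply: ler_sum => j _.
    rewrite innerZl innerZr mulrA -expr2 ler_wpM2l ?sqr_ge0//.
    have j0 : 0 <= j%:R * h l by rewrite mulr_ge0// ltW.
    have jq : j%:R * h l <= q - p.
      by rewrite -[leRHS](lh l) ler_wpM2r ?(ltW (h0 l))// ler_nat ltnW.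
    apply: le_trans (damped_bridge_increment_le kn p0 _ _) _.
    - by rewrite lerDl.
    - by lra.
    rewrite ler_wpM2l//; last by lra.
    apply: mulr_ge0; first by rewrite mulr_ge0// sqr_ge0.
    by rewrite addr_ge0// -exprMn sqr_ge0.
  rewrite sumr_const card_ord -mulr_natl -(lh l).
  by rewrite le_eqVlt; apply/orP; left; apply/eqP; ring.
have YZ : \forall w \ae P, Y l w @[l --> \oo] --> Z w.
  apply: filterS cvgPhi => w /(_ k p q p0 pq qe) cvgw.
  rewrite /Z; have -> : Y ^~ w = (fun l =>
      riemann_sum (fun u => damped_bridge k u w) p q l.+1
      - (q - p) * damped_bridge k p w).
    apply/funext => l; rewrite /Y L2_sumE /riemann_sum -/(h l).
    rewrite -(lh l) mulr_sumr -mulrA -sum_ord_cst -sumrB; apply: eq_bigr => j _.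
    by rewrite -mulrBr.
  apply: cvgB; last exact: cvg_cst.
  by rewrite (cvg_shiftS (riemann_sum (fun u => damped_bridge k u w) p q)).
have EZ := fatou_mean_square mZ YZ YM.
have EZoo : ('E_P[fun w => (Z w ^+ 2)%R] < +oo)%E.
  by rewrite (le_lt_trans EZ) ?ltry.
exists (L2_of_expectation_sqr mZ EZoo) => //.
by rewrite -lee_fin -expectation_sqrE.
Qed.

Definition bridge_riemann_sum (m : nat) : L2 P :=
  \sum_(k < n) \sum_(i < m)
    (eps / m%:R) *: damped_bridge k (i%:R * (eps / m%:R)).

(** There are [n * m] steps of length [eps / m], each contributing an error of
    second moment [O ((eps / m)^3)].  The crude bound on the sum of the errors,
    [(n m)^2] times the bound on each of them, is still [O (1 / m)]. *)
Lemma bridge_integral_approx m : (0 < m)%N ->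
  {E : L2 P | forall w, E w = Phi (grid eps n) w - Phi (grid eps 0) w
                               - bridge_riemann_sum m w &
              inner E E <= C * n%:R ^+ 2 * eps ^+ 3 / m%:R}.
Proof.
move=> m0; have m0' : 0 < m%:R :> R by rewrite ltr0n.
pose h := eps / m%:R; have h0 : 0 < h by rewrite divr_gt0.
have mh : m%:R * h = eps by rewrite /h mulrC divfK// gt_eqF.
have ih (i : 'I_m) : i.+1%:R * h <= eps.
  by rewrite -[leRHS]mh ler_wpM2r ?ler_nat// ltW.
have step (k : 'I_n) (i : 'I_m) : i%:R * h < i.+1%:R * h.
  by rewrite ltr_pM2r// ltr_nat.
have Zki (k : 'I_n) (i : 'I_m) := increment_approx (ltn_ord k)
  (mulr_ge0 (ler0n _ i) (ltW h0)) (step k i) (ih i).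
pose Z k i := s2val (Zki k i).
exists (\sum_k \sum_i Z k i).
  move=> w; rewrite L2_sumE.
  have -> : Phi (grid eps n) w - Phi (grid eps 0) w =
      \sum_(k < n) (Phi (grid eps k.+1) w - Phi (grid eps k) w).
    have := telescope_sumr (fun k => Phi (grid eps k) w) (leq0n n).
    by rewrite big_mkord => ->.
  rewrite /bridge_riemann_sum L2_sumE -sumrB; apply: eq_bigr => k _.
  rewrite !L2_sumE -/h.
  have -> : Phi (grid eps k.+1) w - Phi (grid eps k) w =
      \sum_(i < m) (Phi (grid eps k + i.+1%:R * h) w
                    - Phi (grid eps k + i%:R * h) w).
    have := telescope_sumr (fun i => Phi (grid eps k + i%:R * h) w) (leq0n m).
    by rewrite big_mkord => ->; rewrite mh mul0r addr0 -gridS.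
  rewrite -sumrB; apply: eq_bigr => i _.
  rewrite /Z; case: (Zki k i) => /= z -> _.
  by rewrite -mulrBl -natrB// subSnn mul1r.
apply: le_trans (inner_sqr_sum_le _) _; rewrite card_ord.
apply: (@le_trans _ _ (n%:R * \sum_(k < n) (m%:R * \sum_(i < m) (C * h ^+ 3)))).
  rewrite ler_wpM2l//; apply: ler_sum => k _.
  apply: le_trans (inner_sqr_sum_le _) _; rewrite card_ord.
  rewrite ler_wpM2l//; apply: ler_sum => i _.
  rewrite /Z; case: (Zki k i) => /= z _.
  by rewrite -mulrBl -natrB// subSnn mul1r.
rewrite !sum_ord_cst /h.
by rewrite le_eqVlt; apply/orP; left; apply/eqP; field; rewrite gt_eqF.
Qed.

Lemma bridge_integral : {D : L2 P |
  forall w, D w = Phi (grid eps n) w - Phi (grid eps 0) w &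
  inner (bridge_riemann_sum m) (bridge_riemann_sum m) @[m --> \oo] -->
  inner D D}.
Proof.
have [E EE _] := bridge_integral_approx (ltnSn 0).
exists (E + bridge_riemann_sum 1).
  by move=> w; rewrite -[LHS]/(E w + bridge_riemann_sum 1 w) EE subrK.
set D := E + _; apply: cvg_inner_sqr.
apply: (@squeeze_cvgr _ _ _ _ (fun=> 0)
  (fun m : nat => C * n%:R ^+ 2 * eps ^+ 3 / m%:R)).
- near=> m; rewrite inner_ge0/=.
  have m0 : (0 < m)%N by near: m; exists 1%N.
  have [E' EE' E'le] := bridge_integral_approx m0.
  suff -> : D - bridge_riemann_sum m = E' by [].
  apply/LfuneqP => w; rewrite EE'.
  rewrite -[LHS]/(E w + bridge_riemann_sum 1 w - bridge_riemann_sum m w) EE.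
  by rewrite subrK.
- exact: cvg_cst.
- rewrite -[X in _ --> X](mulr0 (C * n%:R ^+ 2 * eps ^+ 3)).
  apply: cvgMr; rewrite -(cvg_shiftS (fun n => n%:R^-1 : R)).
  exact: cvg_harmonic.
Unshelve. all: by end_near. Qed.

End bridge_integral.

(** * Second moments of the Riemann sums *)

Lemma sum_ord_id (R : realFieldType) m :
  \sum_(i < m) i%:R = m%:R * (m%:R - 1) / 2 :> R.
Proof.
elim: m => [|m IH]; first by rewrite big_ord0 !mul0r.
by rewrite big_ord_recr/= IH -natr1; field.
Qed.

Lemma sum_ord_min (R : realFieldType) m :
  \sum_(i < m) \sum_(j < m) Num.min i%:R j%:R
  = m%:R * (m%:R - 1) * (2 * m%:R - 1) / 6 :> R.
Proof.
elim: m => [|m IH]; first by rewrite big_ord0 !mul0r.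
rewrite big_ord_recr/=; under eq_bigr do rewrite big_ord_recr/=.
rewrite big_split/= IH big_ord_recr/= minxx.
under eq_bigr => i _ do rewrite (@min_l _ _ i%:R) ?ler_nat 1?ltnW//.
have -> : \sum_(i < m) Num.min (m%:R : R) i%:R = \sum_(i < m) i%:R.
  by apply: eq_bigr => i _; rewrite min_r// ler_nat ltnW.
by rewrite sum_ord_id -natr1; field.
Qed.

(** The Riemann sum of the integral [eps^3 / 12] of the bridge kernel over the
    square, in closed form. *)
Lemma sum_bridge_kernel (R : realFieldType) (eps : R) m :
  0 < eps -> (0 < m)%N ->
  let h := eps / m%:R in
  \sum_(i < m) \sum_(j < m)
    (Num.min (i%:R * h) (j%:R * h) - (i%:R * h) * (j%:R * h) / eps) * h ^+ 2
  = eps ^+ 3 / 12 * (1 - m%:R ^- 2).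
Proof.
move=> e0 m0 h; have m1 : m%:R != 0 :> R by rewrite pnatr_eq0 -lt0n.
transitivity (h ^+ 3 * \sum_(i < m) \sum_(j < m) Num.min (i%:R : R) j%:R
  - h ^+ 4 / eps * ((\sum_(i < m) i%:R) * \sum_(j < m) j%:R)).
  rewrite mulr_suml !mulr_sumr -sumrB; apply: eq_bigr => i _.
  rewrite !mulr_sumr -sumrB; apply: eq_bigr => j _.
  have -> : Num.min (i%:R * h) (j%:R * h) = Num.min i%:R j%:R * h.
    by rewrite minr_pMl// divr_ge0// ltW.
  by ring.
rewrite sum_ord_min sum_ord_id /h.
by field; rewrite m1 gt_eqF.
Qed.

Section second_moment_bounds.
Context d (T : measurableType d) (R : realType) (P : probability T R).
Variables (W : R -> L2 P) (eps a : R) (n : nat).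
Hypothesis eps0 : 0 < eps.
Hypothesis cov : forall s t, 0 <= s -> s <= t -> inner (W s) (W t) = s.

Let Q := \sum_(k < n) expR (- (a * grid eps k)) ^+ 2.
Let S m : R := eps ^+ 3 / 12 * (1 - m%:R ^- 2).

(** Distinct cells are uncorrelated, so only the diagonal terms remain; as the
    bridge kernel is nonnegative, the weights [exp (- a (u + v))] can be replaced
    by their bounds. *)
Lemma inner_bridge_riemann_sum_bounds (lo hi : R) m : (0 < m)%N -> 0 <= lo ->
  (forall u, 0 <= u <= eps -> lo <= expR (- (a * u)) <= hi) ->
  lo ^+ 2 * Q * S m <=
    inner (bridge_riemann_sum W eps a n m) (bridge_riemann_sum W eps a n m)
  <= hi ^+ 2 * Q * S m.
Proof.
move=> m0 lo0 lohi; have m0' : 0 < m%:R :> R by rewrite ltr0n.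
pose h := eps / m%:R; have h0 : 0 < h by rewrite divr_gt0.
have mh : m%:R * h = eps by rewrite /h mulrC divfK// gt_eqF.
have ih (i : 'I_m) : 0 <= i%:R * h <= eps.
  by rewrite mulr_ge0 ?(ltW h0)//= -[leRHS]mh ler_wpM2r ?(ltW h0)// ler_nat ltnW.
pose K (i j : 'I_m) :=
  (Num.min (i%:R * h) (j%:R * h) - (i%:R * h) * (j%:R * h) / eps) * h ^+ 2.
have K0 i j : 0 <= K i j.
  rewrite mulr_ge0 ?sqr_ge0// subr_ge0.
  have := ih i; have := ih j.
  move: (i%:R * h) (j%:R * h) => u v /andP[v0 ve] /andP[u0 ue].
  rewrite ler_pdivrMr//; have [uv|vu] := leP u v; first by rewrite ler_wpM2l.
  by rewrite mulrC ler_wpM2l.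
pose x k := expR (- (a * grid eps k)).
pose y (i : 'I_m) := expR (- (a * (i%:R * h))).
have y0 i : 0 <= y i by exact: expR_ge0.
have -> : inner (bridge_riemann_sum W eps a n m) (bridge_riemann_sum W eps a n m)
    = \sum_(k < n) x k ^+ 2 * \sum_(i < m) \sum_(j < m) y i * y j * K i j.
  rewrite /bridge_riemann_sum inner_suml; apply: eq_bigr => k _.
  rewrite inner_sumr (bigD1 k)//= [X in _ + X]big1 ?addr0 => [|l lk].
    rewrite inner_suml mulr_sumr; apply: eq_bigr => i _.
    rewrite inner_sumr mulr_sumr; apply: eq_bigr => j _.
    rewrite /damped_bridge !(innerZl, innerZr) (inner_bridge eps0 cov)// -/h.
    rewrite !mulrDr !opprD !expRD /K /x /y; ring.
  rewrite inner_suml big1// => i _; rewrite inner_sumr big1// => j _.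
  rewrite /damped_bridge !(innerZl, innerZr) (inner_bridge_neq eps0 cov)//.
    by rewrite !mulr0.
  by rewrite eq_sym.
have lo2 i j : lo ^+ 2 <= y i * y j <= hi ^+ 2.
  have /andP[l1 h1] := lohi _ (ih i); have /andP[l2 h2] := lohi _ (ih j).
  by rewrite !expr2 !ler_pM.
have SE : \sum_i \sum_j K i j = S m by rewrite sum_bridge_kernel.
have QE c : c * Q * S m = \sum_(k < n) x k ^+ 2 * \sum_i \sum_j (c * K i j).
  rewrite mulrAC mulr_sumr; apply: eq_bigr => k _; rewrite mulrC; congr (_ * _).
  by rewrite -SE mulr_sumr; apply: eq_bigr => i _; rewrite mulr_sumr.
rewrite !QE; apply/andP; split; apply: ler_sum => k _;
  (rewrite ler_wpM2l ?sqr_ge0//; apply: ler_sum => i _; apply: ler_sum => j _;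
  by rewrite ler_wpM2r//; case/andP: (lo2 i j)).
Qed.

Lemma inner_limit_bounds (D : L2 P) (lo hi : R) : 0 <= lo ->
  (forall u, 0 <= u <= eps -> lo <= expR (- (a * u)) <= hi) ->
  inner (bridge_riemann_sum W eps a n m) (bridge_riemann_sum W eps a n m)
    @[m --> \oo] --> inner D D ->
  lo ^+ 2 * Q * (eps ^+ 3 / 12) <= inner D D <= hi ^+ 2 * Q * (eps ^+ 3 / 12).
Proof.
move=> lo0 lohi cvgD.
have cvgS c : c * S m @[m --> \oo] --> c * (eps ^+ 3 / 12).
  apply: cvgMr; rewrite -[X in _ --> X]mulr1; apply: cvgMr.
  rewrite -[X in _ --> X]subr0; apply: cvgB; first exact: cvg_cst.
  have cvginv : (m%:R^-1 : R) @[m --> \oo] --> 0.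
    by rewrite -(cvg_shiftS (fun n => n%:R^-1 : R)); exact: cvg_harmonic.
  have -> : (fun m => m%:R ^- 2) = (fun m : nat => m%:R^-1 * m%:R^-1 : R).
    by apply/funext => m; rewrite -exprVn expr2.
  have := cvgM cvginv cvginv; rewrite mulr0; exact.
apply/andP; split.
- apply: (ler_cvg_to (cvgS _) cvgD); near=> m.
  have m0 : (0 < m)%N by near: m; exists 1%N.
  by have /andP[] := inner_bridge_riemann_sum_bounds m0 lo0 lohi.
- apply: (ler_cvg_to cvgD (cvgS _)); near=> m.
  have m0 : (0 < m)%N by near: m; exists 1%N.
  by have /andP[] := inner_bridge_riemann_sum_bounds m0 lo0 lohi.
Unshelve. all: by end_near. Qed.

End second_moment_bounds.

Lemma geometric_damping (R : realType) (a eps : R) n :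
  let q := expR (2 * a * eps) in
  expR (2 * a * grid eps n) * (\sum_(k < n) expR (- (a * grid eps k)) ^+ 2)
    * (q - 1)
  = q * (expR (2 * a * grid eps n) - 1).
Proof.
move=> q; elim: n => [|n IH].
  by rewrite big_ord0 mulr0 mul0r /grid mul0r mulr0 expR0 subrr mulr0.
have -> : expR (2 * a * grid eps n.+1) = expR (2 * a * grid eps n) * q.
  by rewrite gridS mulrDr expRD.
rewrite big_ord_recr/=; set E := expR (2 * a * grid eps n) in IH *.
have -> : expR (- (a * grid eps n)) ^+ 2 = E^-1.
  by rewrite expr2 -expRD -expRN; congr expR; ring.
have E0 : E != 0 by rewrite gt_eqF// expR_gt0.
move: IH; set Q := \sum_(k < n) _ => IH.
transitivity (q * (E * Q * (q - 1)) + q * (q - 1)); first by field.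
by rewrite IH; ring.
Qed.

(** * The discretization error *)

Lemma interpolation_defect (R : realType) (eps : R) (b : R -> R) k u :
  0 < eps -> 0 <= u < eps ->
  b (grid eps k + u) - interpolation eps b (grid eps k + u) =
  b (grid eps k + u) - b (grid eps k)
  - u / eps * (b (grid eps k.+1) - b (grid eps k)).
Proof.
move=> eps0 /andP[u0 ue]; rewrite /interpolation.
have -> : Num.truncn ((grid eps k + u) / eps) = k.
  apply: truncn_def; rewrite ler_pdivlMr// ltr_pdivrMr//.
  by rewrite -natr1 mulrDl mul1r /grid lerDl u0 ltrD2l.
by rewrite addrAC subrr add0r; ring.
Qed.

Lemma interpolation_grid (R : realType) (eps : R) (b : R -> R) k :
  0 < eps -> interpolation eps b (grid eps k) = b (grid eps k).
Proof.
move=> eps0; have := @interpolation_defect R eps b k 0 eps0.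
rewrite lexx eps0 addr0 mul0r mul0r subr0 subrr => /(_ isT) /eqP.
by rewrite subr_eq0 => /eqP.
Qed.

Lemma linear_equation_difference (R : realType) (a x : R) (z y zb yb : R -> R) :
  {within `[0, +oo[, continuous y} ->
  (forall t, 0 <= t ->
     y t = x + a * (\int[lebesgue_measure]_(s in `[0, t]) y s) + (z t - z 0)) ->
  {within `[0, +oo[, continuous yb} ->
  (forall t, 0 <= t ->
     yb t = x + a * (\int[lebesgue_measure]_(s in `[0, t]) yb s)
            + (zb t - zb 0)) ->
  zb 0 = z 0 ->
  {within `[0, +oo[, continuous (fun t => y t - yb t)} /\
  forall t, 0 <= t -> y t - yb t =
    a * (\int[lebesgue_measure]_(s in `[0, t]) (y s - yb s)) + (z t - zb t).
Proof.
move=> cy yE cyb ybE z0; split=> [|t t0].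
  move=> s; apply: cvgB; [exact: cy|exact: cyb].
have sub : `[0, t] `<=` `[0, +oo[.
  by move=> s /=; rewrite !in_itv/= andbT => /andP[].
have int (f : R -> R) : {within `[0, +oo[, continuous f} ->
    lebesgue_measure.-integrable `[0, t] (EFin \o f).
  move=> cf; apply: continuous_compact_integrable; first exact: segment_compact.
  exact: continuous_subspaceW sub cf.
rewrite RintegralB//; [|exact: int..].
by rewrite (yE t t0) (ybE t t0) z0; ring.
Qed.

Section error_second_moment.
Context d (T : measurableType d) (R : realType) (P : probability T R).
Variables (a eps x : R) (B X Xbar : R -> {RV P >-> R}).
Hypothesis eps0 : 0 < eps.
Hypothesis hB : standard_brownian_motion B.
Hypothesis hX : linear_sde_solution a x (fun t w => B t w) X.
Hypothesis hXbar : linear_sde_solution a x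
  (fun t w => interpolation eps (fun s => B s w) t) Xbar.

Let beta t w := B t w - interpolation eps (fun s => B s w) t.

Let Delta t w := X t w - Xbar t w.

Lemma error_equation : \forall w \ae P,
  {within `[0, +oo[, continuous (fun t => Delta t w)} /\
  forall t, 0 <= t -> Delta t w =
    a * (\int[lebesgue_measure]_(s in `[0, t]) Delta s w) + beta t w.
Proof.
apply: filterS2 hX hXbar => w [cX XE] [cXbar XbarE].
apply: (linear_equation_difference cX XE cXbar XbarE).
by have := @interpolation_grid R eps (fun s => B s w) 0 eps0; rewrite /grid mul0r.
Qed.

Lemma bridge_positionE k u w : 0 <= u < eps ->
  bridge (position hB) eps k u w = beta (grid eps k + u) w.
Proof.
move=> uI; rewrite /beta interpolation_defect//; case/andP: uI => u0 _.
have k0 := grid_ge0 eps0 k; have k1 := grid_ge0 eps0 k.+1.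
rewrite /bridge.
rewrite -[LHS]/(position hB (grid eps k + u) w - position hB (grid eps k) w
  - u / eps * (position hB (grid eps k.+1) w - position hB (grid eps k) w)).
by rewrite !positionE ?addr_ge0//; ring.
Qed.

(** Where the error equation holds, this is [exp (- a t)] times the integral of
    [Delta] over [[0, t]]; this form makes it measurable for each [t]. *)
Definition damped_integral t w :=
  expR (- (a * t)) * ((Delta t w - beta t w) / a).

Lemma measurable_damped_integral t : measurable_fun setT (damped_integral t).
Proof.
apply: measurable_funM => //; apply: measurable_funM => //.
apply: measurable_funB; first exact: measurable_funB.
apply: measurable_funB => //; apply: measurable_funD => //.
by apply: measurable_funM => //; exact: measurable_funB.
Qed.

Lemma cvg_damped_integral : a != 0 -> \forall w \ae P,
  forall k p q, 0 <= p -> p < q -> q <= eps ->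
  riemann_sum (fun u => damped_bridge (position hB) eps a k u w) p q l
    @[l --> \oo] -->
  damped_integral (grid eps k + q) w - damped_integral (grid eps k + p) w.
Proof.
move=> a0; apply: filterS error_equation => w [cD DE] k p q p0 pq qe.
have k0 := grid_ge0 eps0 k.
have IE t : 0 <= t -> damped_integral t w =
    expR (- (a * t)) * \int[lebesgue_measure]_(s in `[0, t]) Delta s w.
  by move=> t0; rewrite /damped_integral (DE t t0) addrK mulrAC divff// mul1r.
have kp0 : 0 <= grid eps k + p by rewrite addr_ge0.
have kpq : grid eps k + p < grid eps k + q by rewrite ltrD2l.
rewrite !IE ?(le_trans kp0 (ltW kpq))//.
suff -> : (riemann_sum (fun u => damped_bridge (position hB) eps a k u w) p q)
    = riemann_sum (fun s => expR (- (a * s)) * beta s w)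
        (grid eps k + p) (grid eps k + q).
  exact: (cvg_riemann_sum_linear_ode cD DE kp0 kpq).
apply/funext => l.
rewrite /riemann_sum opprD addrACA subrr add0r; congr (_ * _).
apply: eq_bigr => j _.
have l0 : 0 < l%:R :> R by rewrite ltr0n (leq_ltn_trans _ (ltn_ord j)).
set h := (q - p) / l%:R.
have h0 : 0 < h by rewrite divr_gt0// subr_gt0.
have lh : l%:R * h = q - p by rewrite /h mulrC divfK// gt_eqF.
have jh : j%:R * h < q - p by rewrite -[ltRHS]lh ltr_pM2r// ltr_nat.
have jh0 : 0 <= j%:R * h by rewrite mulr_ge0// ltW.
rewrite -addrA -bridge_positionE//.
by apply/andP; split; lra.
Qed.

(** At a grid time [Delta] is [a exp (a t_n)] times the damped integral, the
    mean-square limit of the Riemann sums of the damped bridges. *)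
Lemma error_second_moment (lo hi : R) n : a != 0 -> 0 <= lo ->
  (forall u, 0 <= u <= eps -> lo <= expR (- (a * u)) <= hi) ->
  let A := a ^+ 2 * (eps ^+ 3 / 12) *
    (expR (2 * a * grid eps n) * \sum_(k < n) expR (- (a * grid eps k)) ^+ 2) in
  exists2 v, ('E_P[fun w => ((X (grid eps n) w - Xbar (grid eps n) w) ^+ 2)%R]
              = v%:E)%E
    & lo ^+ 2 * A <= v <= hi ^+ 2 * A.
Proof.
move=> a0 lo0 lohi A.
have cov := inner_position hB.
have [D DE cvgD] := bridge_integral n eps0 cov measurable_damped_integral
  (cvg_damped_integral a0).
have := inner_limit_bounds eps0 cov lo0 lohi cvgD.
set Q := \sum_(k < n) _ => DQ.
pose c := a * expR (a * grid eps n).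
have c2 : c ^+ 2 = a ^+ 2 * expR (2 * a * grid eps n).
  by rewrite /c exprMn (expr2 (expR _)) -expRD; congr (_ * expR _); ring.
exists (c ^+ 2 * inner D D).
  have -> : ((c ^+ 2 * inner D D)%:E =
      'E_P[fun w => ((c *: D : L2 P) w ^+ 2)%R])%E.
    by rewrite expectation_sqrE innerZl innerZr mulrA.
  rewrite unlock; apply: ge0_ae_eq_integral => //.
  - exact/measurable_EFinP/measurable_funX/measurable_funB.
  - exact/measurable_EFinP/measurable_funX/measurable_L2.
  - by move=> w _; rewrite lee_fin sqr_ge0.
  - by move=> w _; rewrite lee_fin sqr_ge0.
  apply: filterS error_equation => w [_ Dw] _; congr (_ ^+ 2)%:E.
  rewrite -[RHS]/(c * D w) DE /damped_integral /beta !interpolation_grid//.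
  rewrite !subrr !subr0.
  have -> : Delta (grid eps 0) w = 0.
    rewrite /grid mul0r Dw// set_itv1 Rintegral_set1 mulr0 add0r /beta.
    have := @interpolation_grid R eps (fun s => B s w) 0 eps0.
    by rewrite /grid mul0r => ->; rewrite subrr.
  rewrite mul0r mulr0 subr0 /c mulrA -(mulrA a) -expRD subrr expR0 mulr1.
  by rewrite mulrC divfK.
have c20 : 0 <= c ^+ 2 by exact: sqr_ge0.
have AE r : r * A = c ^+ 2 * (r * Q * (eps ^+ 3 / 12)).
  by rewrite c2 /A -/Q; ring.
by rewrite !AE !ler_wpM2l//; case/andP: DQ.
Qed.

End error_second_moment.

(** * The error bounds *)

Theorem mainTheorem6 (d : measure_display) (T : measurableType d)
  (R : realType) (P : probability T R) (a eps : R) (heps : 0 < eps)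
  (B : R -> {RV P >-> R}) (hB : standard_brownian_motion B)
  (x : R) (X Xbar : R -> {RV P >-> R})
  (hX : linear_sde_solution a x (fun t w => B t w) X)
  (hXbar : linear_sde_solution a x
     (fun t w => interpolation eps (fun s => B s w) t) Xbar) :
  (a < 0 ->
    (ereal_sup (range (fun n : nat =>
       'E_P[fun w => ((X (grid eps n) w - Xbar (grid eps n) w) ^+ 2)%R]))
     <= (expR (2 * `|a| * eps) * (`|a| / 24) * eps ^+ 2)%R%:E)%E)
  /\
  (0 < a -> forall n : nat,
    ((eps ^+ 2 * (a / 24 * expR (- (2 * a * eps)))
        * (expR (2 * a * grid eps n) - 1))%R%:E
     <= 'E_P[fun w => ((X (grid eps n) w - Xbar (grid eps n) w) ^+ 2)%R])%E
    /\
    ('E_P[fun w => ((X (grid eps n) w - Xbar (grid eps n) w) ^+ 2)%R]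
     <= (eps ^+ 2 * (a / 24 * expR (2 * a * eps))
          * (expR (2 * a * grid eps n) - 1))%R%:E)%E).
Proof.
have qE : expR (- (2 * a * eps)) * expR (2 * a * eps) = 1.
  by rewrite mulrC expRxMexpNx_1.
have S0 n : 0 <= expR (2 * a * grid eps n)
    * \sum_(k < n) expR (- (a * grid eps k)) ^+ 2.
  by rewrite mulr_ge0 ?expR_ge0// sumr_ge0// => k _; rewrite sqr_ge0.
(* [q = exp (2 a eps)] is the ratio of the geometric progression: the lower
   bound [q1] on [q - 1] serves the upper estimate for a > 0, and
   [1 - 1 / q <= 2 a eps], that is [q2], the other two *)
have q0 := expR_gt0 (2 * a * eps).
have q1 := expR_ge1Dx (2 * a * eps).
have q2 := ler_wpM2l (ltW q0) (expR_ge1Dx (- (2 * a * eps))).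
rewrite [X in _ <= X]mulrC qE in q2.
have geo n := geometric_damping a eps n.
move: (expR (2 * a * eps)) qE q0 q1 q2 geo => q qE q0 q1 q2 /= geo.
have sqrE (r : R) : expR r ^+ 2 = expR (2 * r).
  by rewrite expr2 -expRD; congr expR; ring.
split=> [a0|a0 n].
- apply: ge_ereal_sup => _ [n _ <-].
  have lohi u : 0 <= u <= eps -> 0 <= expR (- (a * u)) <= expR (- (a * eps)).
    move=> /andP[u0 ue]; rewrite expR_ge0/= ler_expR lerN2.
    by rewrite ler_nM2l.
  have [v -> /andP[_ vA]] :=
    error_second_moment heps hB hX hXbar n (ltr0_neq0 a0) (lexx 0) lohi.
  rewrite lee_fin; apply: le_trans vA _; rewrite sqrE ltr0_norm//.
  have -> : 2 * - (a * eps) = - (2 * a * eps) by ring.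
  have -> : 2 * - a * eps = - (2 * a * eps) by ring.
  rewrite -[leRHS]mulrA ler_wpM2l ?expR_ge0//.
  have := geo n; have := S0 n; set S := _ * \sum_(k < n) _.
  have E0 := expR_gt0 (2 * a * grid eps n).
  move: (expR (2 * a * grid eps n)) E0 => E E0 {}S0 SE.
  have -> : a ^+ 2 * (eps ^+ 3 / 12) * S =
      - a / 24 * eps ^+ 2 * (2 * - a * eps * S) by field.
  rewrite ler_piMr//.
    by rewrite mulr_ge0 ?sqr_ge0// divr_ge0// oppr_ge0 ltW.
  rewrite -(ler_pM2l q0).
  have qS : q * (2 * - a * eps) * S <= (1 - q) * S.
    by rewrite ler_wpM2r//; lra.
  have qE0 : 0 <= q * E by rewrite mulr_ge0 ?ltW.
  by lra.
- have lohi u : 0 <= u <= eps -> expR (- (a * eps)) <= expR (- (a * u)) <= 1.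
    move=> /andP[u0 ue]; rewrite ler_expR expR_le1 lerN2 oppr_le0.
    by rewrite ler_pM2l// ue mulr_ge0// ltW.
  have [v -> /andP[Av vA]] :=
    error_second_moment heps hB hX hXbar n (lt0r_neq0 a0) (expR_ge0 _) lohi.
  have aeps : 0 < a * eps by rewrite mulr_gt0.
  have c0 : 0 < a / 24 * eps ^+ 2 by rewrite mulr_gt0 ?exprn_gt0 ?divr_gt0.
  move: Av vA; rewrite sqrE expr1n mul1r !lee_fin.
  have -> : 2 * - (a * eps) = - (2 * a * eps) by ring.
  have := geo n; have := S0 n; set S := _ * \sum_(k < n) _.
  have -> : a ^+ 2 * (eps ^+ 3 / 12) * S =
      a / 24 * eps ^+ 2 * (2 * a * eps * S) by field.
  move: (expR (2 * a * grid eps n)) => E {}S0 SE Av vA; split.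
    apply: le_trans Av.
    rewrite [leLHS](_ : _ = expR (- (2 * a * eps)) *
      (a / 24 * eps ^+ 2 * (E - 1))); last ring.
    rewrite ler_wpM2l ?expR_ge0// ler_wpM2l ?(ltW c0)//.
    rewrite -(ler_pM2l q0) -SE.
    have qS : (q - 1) * S <= q * (2 * a * eps) * S.
    by rewrite ler_wpM2r//; lra.
    by lra.
  apply: (le_trans vA).
  rewrite [leRHS](_ : _ = a / 24 * eps ^+ 2 * (q * (E - 1))); last ring.
  by rewrite ler_wpM2l ?(ltW c0)// -SE mulrC ler_wpM2l//; lra.
Qed.
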